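(* Consider, on one element of a one-dimensional mesh with nodes $j=0,\dots,N$, quadrature weights $\omega_j>0$ and constant mapping Jacobian $J>0$, a discretization scheme for a non-conservative system that is obtained by blending two schemes at the element level, $$J\omega_j\,\dot{\mathbf u}_j=(1-\alpha)\,\mathbf F_j^{\mathrm{DG}}+\alpha\,\mathbf F_j^{\mathrm{FV}},\qquad j=0,\dots,N,$$ where $\alpha$ is an element-local blending coefficient (the same for all $j$ in the element), and both of the schemes are of the form $$\mathbf F^i_j=\delta_{j0}\left(\hat{\mathbf f}^a_{(0,L)}+\boldsymbol\Phi^{\Diamond}_{(0,L)}\right)-\delta_{jN}\left(\hat{\mathbf f}^a_{(N,R)}+\boldsymbol\Phi^{\Diamond}_{(N,R)}\right)+\mathbf F^i_{K,j},\qquad i\in\{\mathrm{DG},\mathrm{FV}\},$$ with $\mathbf F^i_{K,j}$ being any discretization terms that depend only on the inner states $\mathbf u_0,\dots,\mathbf u_N$ of the element. Then the semi-discrete entropy balance of the blended scheme is $$\sum_{j=0}^N J\omega_j\dot S_j=\underbrace{\hat f^S_{(0,L)}-\hat f^S_{(N,R)}+\tfrac12\left(r_{(L,0)}+r_{(N,R)}\right)}_{\dot S_{\partial K}}+(1-\alpha)\,\dot S_K^{\mathrm{DG}}+\alpha\,\dot S_K^{\mathrm{FV}},$$ where $\dot S_{\partial K}$ consists of the numerical entropy flux and entropy production on the element boundaries, which are intrinsic to the choice of the surface numerical flux and the surface non-conservative term, and $\dot S_K^i$ is the entropy production of scheme $i$ inside the element, which depends only on inner states.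
   Context: Setting. The system has state vector $\mathbf u$, a strictly convex entropy function $S(\mathbf u)$, entropy variables $\mathbf v=\partial S/\partial\mathbf u$, and a scalar entropy flux potential $\Psi=\Psi(\mathbf u)$. (For the one-dimensional GLM-MHD system, $\Psi=\mathbf v^T\mathbf f^a-f^S+\theta B_1$, where $\mathbf f^a$ is the advective flux, $f^S$ the entropy flux, $B_1$ the first magnetic field component and $\theta=\mathbf v^T\boldsymbol\phi^{\mathrm{MHD}}$ the contraction of $\mathbf v$ with the coefficient vector $\boldsymbol\phi^{\mathrm{MHD}}$ of the Powell non-conservative term $\boldsymbol\phi^{\mathrm{MHD}}\,\partial_xB_1$.) A subscript $j$ on a function of the state means evaluation at $\mathbf u_j$. The indices $L$ and $R$ denote the outer states $\mathbf u_L,\mathbf u_R$ adjacent to the left and right boundaries of the element. $\dot{\ }$ denotes the (semi-discrete) time derivative, and $\dot S_j=\mathbf v_j^T\dot{\mathbf u}_j$. $\hat{\mathbf f}^a_{(j,k)}=\hat{\mathbf f}^a(\mathbf u_j,\mathbf u_k)$ is a surface numerical flux, symmetric in its two arguments, $\hat{\mathbf f}^a_{(j,k)}=\hat{\mathbf f}^a_{(k,j)}$, and consistent, $\hat{\mathbf f}^a(\mathbf u,\mathbf u)=\mathbf f^a(\mathbf u)$. $\boldsymbol\Phi^\Diamond_{(j,k)}=\boldsymbol\Phi^\Diamond(\mathbf u_j,\mathbf u_k)$ is a surface numerical non-conservative term, in general not symmetric. Both schemes use the same $\hat{\mathbf f}^a$ and $\boldsymbol\Phi^\Diamond$ on the element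 boundaries. Notation: $[\![a]\!]_{(j,k)}=a_k-a_j$ and $\{\!\{a\}\!\}_{(j,k)}=\tfrac12(a_j+a_k)$. Numerical entropy flux: $$\hat f^S_{(j,k)}=\{\!\{\mathbf v\}\!\}_{(j,k)}^T\hat{\mathbf f}^a_{(j,k)}+\tfrac12\mathbf v_j^T\boldsymbol\Phi^\Diamond_{(j,k)}+\tfrac12\mathbf v_k^T\boldsymbol\Phi^\Diamond_{(k,j)}-\{\!\{\Psi\}\!\}_{(j,k)}.$$ Entropy production: $$r_{(j,k)}=[\![\mathbf v]\!]_{(j,k)}^T\hat{\mathbf f}^a_{(j,k)}+\mathbf v_k^T\boldsymbol\Phi^\Diamond_{(k,j)}-\mathbf v_j^T\boldsymbol\Phi^\Diamond_{(j,k)}-[\![\Psi]\!]_{(j,k)}.$$ Entropy production of scheme $i$ inside the element: $$\dot S_K^i=\sum_{j=0}^N\mathbf v_j^T\mathbf F^i_{K,j}+\Psi_0-\Psi_N.$$ *)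

(* Defs.v *)
From HB Require Import structures.
From mathcomp Require Import all_boot all_order all_algebra.
From mathcomp Require Import all_classical all_reals all_analysis.
Set Implicit Arguments.
Unset Strict Implicit.
Unset Printing Implicit Defensive.
Import Order.TTheory GRing.Theory Num.Theory.
Import numFieldNormedType.Exports.
Local Open Scope classical_set_scope.
Local Open Scope ring_scope.

Definition dotv (R : realType) (m : nat) (x y : 'cV[R]_m) : R :=
  (x^T *m y) 0 0.

(* The library's [convex_function] has no strict counterpart. *)
Definition strictly_convex_on (R : realType) (m : nat)
    (D : set 'cV[R]_m) (f : 'cV[R]_m -> R) : Prop :=
  forall (x y : 'cV[R]_m) (l : R), D x -> D y -> x != y -> 0 < l -> l < 1 ->
  f (l *: x + (1 - l) *: y) < l * f x + (1 - l) * f y.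

(* [Omega] is the set of admissible states (for MHD: positive density and
   pressure); values of [S] outside it are irrelevant since it is open. *)
Definition strictly_convex_entropy (R : realType) (m : nat)
    (Omega : set 'cV[R]_m) (S : 'cV[R]_m -> R) : Prop :=
  [/\ open Omega, convex_set Omega, strictly_convex_on Omega S &
      forall u, Omega u -> differentiable S u].

(* v = dS/du, the column of partial derivatives of S. *)
Definition entropy_vars (R : realType) (m : nat) (S : 'cV[R]_m -> R)
    (u : 'cV[R]_m) : 'cV[R]_m :=
  \col_i 'D_(delta_mx i 0) S u.

(* In [jump], [mean] and all two-point quantities the arguments [uj uk]
   correspond, in this order, to the subscript (j,k). *)
Definition jump (U : Type) (V : zmodType) (a : U -> V) (uj uk : U) : V :=
  a uk - a uj.

Definition mean (R : realType) (U : Type) (V : lmodType R) (a : U -> V)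
    (uj uk : U) : V :=
  2^-1 *: (a uj + a uk).

Definition entropy_flux (R : realType) (m : nat) (v : 'cV[R]_m -> 'cV[R]_m)
    (Psi : 'cV[R]_m -> R) (fhat Phi : 'cV[R]_m -> 'cV[R]_m -> 'cV[R]_m)
    (uj uk : 'cV[R]_m) : R :=
  dotv (mean v uj uk) (fhat uj uk)
  + 2^-1 * dotv (v uj) (Phi uj uk) + 2^-1 * dotv (v uk) (Phi uk uj)
  - mean (Psi : 'cV[R]_m -> R^o) uj uk.

Definition entropy_production (R : realType) (m : nat)
    (v : 'cV[R]_m -> 'cV[R]_m) (Psi : 'cV[R]_m -> R)
    (fhat Phi : 'cV[R]_m -> 'cV[R]_m -> 'cV[R]_m) (uj uk : 'cV[R]_m) : R :=
  dotv (jump v uj uk) (fhat uj uk)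
  + dotv (v uk) (Phi uk uj) - dotv (v uj) (Phi uj uk)
  - jump Psi uj uk.

(* [u] lists the nodal states u_0, ..., u_N of the element.  The type of
   [FK] makes the volume terms functions of these inner states only. *)
Definition scheme_rhs (R : realType) (m N : nat)
    (fhat Phi : 'cV[R]_m -> 'cV[R]_m -> 'cV[R]_m)
    (FK : ('I_N.+1 -> 'cV[R]_m) -> 'I_N.+1 -> 'cV[R]_m)
    (uL uR : 'cV[R]_m) (u : 'I_N.+1 -> 'cV[R]_m) (j : 'I_N.+1) : 'cV[R]_m :=
  (j == ord0)%:R *: (fhat (u ord0) uL + Phi (u ord0) uL)
  - (j == ord_max)%:R *: (fhat (u ord_max) uR + Phi (u ord_max) uR)
  + FK u j.

Definition inner_entropy_production (R : realType) (m N : nat)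
    (v : 'cV[R]_m -> 'cV[R]_m) (Psi : 'cV[R]_m -> R)
    (FK : ('I_N.+1 -> 'cV[R]_m) -> 'I_N.+1 -> 'cV[R]_m)
    (u : 'I_N.+1 -> 'cV[R]_m) : R :=
  \sum_(j < N.+1) dotv (v (u j)) (FK u j) + Psi (u ord0) - Psi (u ord_max).

Definition boundary_entropy_balance (R : realType) (m : nat)
    (v : 'cV[R]_m -> 'cV[R]_m) (Psi : 'cV[R]_m -> R)
    (fhat Phi : 'cV[R]_m -> 'cV[R]_m -> 'cV[R]_m)
    (uL u0 uN uR : 'cV[R]_m) : R :=
  entropy_flux v Psi fhat Phi u0 uL - entropy_flux v Psi fhat Phi uN uR
  + 2^-1 * (entropy_production v Psi fhat Phi uL u0
            + entropy_production v Psi fhat Phi uN uR).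

(* Main.v *)
(* By symmetry of the surface flux, [f^S_(0,L) + r_(L,0) / 2] collapses to
   [v_0^T (f_(0,L) + Phi_(0,L)) - Psi_0] and [f^S_(N,R) - r_(N,R) / 2] to
   [v_N^T (f_(N,R) + Phi_(N,R)) - Psi_N].  Contracting either scheme with the
   entropy variables thus gives the same boundary balance plus its own inner
   production; the blend has total weight 1, so the boundary part is unchanged. *)
Require Import Defs.
From HB Require Import structures.
From mathcomp Require Import all_boot all_order all_algebra.
From mathcomp Require Import ring.
From mathcomp Require Import all_classical all_reals all_analysis.
Set Implicit Arguments.
Unset Strict Implicit.
Unset Printing Implicit Defensive.
Import Order.TTheory GRing.Theory Num.Theory.
Import numFieldNormedType.Exports.
Local Open Scope classical_set_scope.
Local Open Scope ring_scope.

Lemma dotvDr (R : realType) (m : nat) (x y z : 'cV[R]_m) :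
  dotv x (y + z) = dotv x y + dotv x z.
Proof. by rewrite /dotv mulmxDr mxE. Qed.

Lemma dotvZr (R : realType) (m : nat) (a : R) (x y : 'cV[R]_m) :
  dotv x (a *: y) = a * dotv x y.
Proof. by rewrite /dotv -scalemxAr mxE. Qed.

Lemma dotvNr (R : realType) (m : nat) (x y : 'cV[R]_m) :
  dotv x (- y) = - dotv x y.
Proof. by rewrite /dotv mulmxN mxE. Qed.

Lemma dotvDl (R : realType) (m : nat) (x y z : 'cV[R]_m) :
  dotv (x + y) z = dotv x z + dotv y z.
Proof. by rewrite /dotv linearD mulmxDl mxE. Qed.

Lemma dotvZl (R : realType) (m : nat) (a : R) (x y : 'cV[R]_m) :
  dotv (a *: x) y = a * dotv x y.
Proof. by rewrite /dotv linearZ -scalemxAl mxE. Qed.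

Lemma dotvNl (R : realType) (m : nat) (x y : 'cV[R]_m) :
  dotv (- x) y = - dotv x y.
Proof. by rewrite /dotv linearN mulNmx mxE. Qed.

(** Expanding [w] in the canonical basis and using linearity of the differential leaves the
    derivatives of [S] along [delta_mx i 0], which are the coordinates of [entropy_vars S u]. *)
Lemma diff_entropy_vars (R : realType) (m : nat) (S : 'cV[R]_m -> R)
    (u w : 'cV[R]_m) :
  differentiable S u -> 'd S u w = dotv (entropy_vars S u) w.
Proof.
move=> dS; rewrite /dotv mxE [in LHS](matrix_sum_delta w) linear_sum /=.
apply: eq_bigr => i _; rewrite big_ord1 linearZ /= !mxE deriveE //.
by rewrite mulrC.
Qed.

(** Chain rule: a derivative in time is the differential applied to [1], and that of [S \o u]
    factors through ['d S (u t)]. *)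
Lemma derive1_entropy (R : realType) (m : nat) (S : 'cV[R]_m -> R)
    (u : R -> 'cV[R]_m) (t : R) :
  differentiable S (u t) -> derivable u t 1 ->
  (S \o u)^`()%classic t = dotv (entropy_vars S (u t)) (u^`()%classic t).
Proof.
move=> dS /derivable1_diffP du.
rewrite !derive1E !deriveE//; last exact: differentiable_comp.
by rewrite diff_comp//= diff_entropy_vars.
Qed.

(** At each face the mean of [v] plus or minus half its jump is [v] at the inner node, so the outer
    values of [v] and [Psi] cancel. The left face pairs a flux at [(u0, uL)] with a production at
    [(uL, u0)]; [sym0L] identifies their [fhat]. *)
Lemma boundary_entropy_balanceE (R : realType) (m : nat)
    (v : 'cV[R]_m -> 'cV[R]_m) (Psi : 'cV[R]_m -> R)
    (fhat Phi : 'cV[R]_m -> 'cV[R]_m -> 'cV[R]_m)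
    (uL u0 uN uR : 'cV[R]_m) :
  fhat uL u0 = fhat u0 uL ->
  boundary_entropy_balance v Psi fhat Phi uL u0 uN uR
  = (dotv (v u0) (fhat u0 uL + Phi u0 uL) - Psi u0)
    - (dotv (v uN) (fhat uN uR + Phi uN uR) - Psi uN).
Proof.
move=> sym0L.
rewrite /boundary_entropy_balance /entropy_flux /entropy_production.
rewrite /mean /jump sym0L.
(* The mean of [Psi] scales in [R^o]; unfolding [GRing.scale] turns this into a product that [field]
   can read. *)
rewrite !(dotvZl, dotvDl, dotvNl, dotvDr) /GRing.scale /=.
by field.
Qed.

(** The Kronecker deltas select the two face contractions; the terms [Psi] at [ord0] and [ord_max]
    in the inner production cancel those in the boundary balance. For [N = 0] both deltas select the
    same node. *)
Lemma sum_dotv_scheme_rhs (R : realType) (m N : nat)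
    (v : 'cV[R]_m -> 'cV[R]_m) (Psi : 'cV[R]_m -> R)
    (fhat Phi : 'cV[R]_m -> 'cV[R]_m -> 'cV[R]_m)
    (FK : ('I_N.+1 -> 'cV[R]_m) -> 'I_N.+1 -> 'cV[R]_m)
    (uL uR : 'cV[R]_m) (u : 'I_N.+1 -> 'cV[R]_m) :
  fhat uL (u ord0) = fhat (u ord0) uL ->
  \sum_(j < N.+1) dotv (v (u j)) (scheme_rhs fhat Phi FK uL uR u j)
  = boundary_entropy_balance v Psi fhat Phi uL (u ord0) (u ord_max) uR
    + inner_entropy_production v Psi FK u.
Proof.
move=> sym0L; rewrite boundary_entropy_balanceE // /inner_entropy_production.
have pick (k : 'I_N.+1) (w : 'cV[R]_m) :
    \sum_(j < N.+1) (j == k)%:R * dotv (v (u j)) w = dotv (v (u k)) w.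
  rewrite (bigD1 k) //= eqxx mul1r big1 ?addr0 // => j /negPf ->.
  by rewrite mul0r.
under eq_bigr => j _ do
  rewrite /scheme_rhs dotvDr dotvDr dotvNr !dotvZr.
rewrite !big_split /= sumrN !pick.
by ring.
Qed.

Theorem lemma3 (R : realType) (m N : nat)
    (Omega : set 'cV[R]_m) (S Psi : 'cV[R]_m -> R)
    (fa : 'cV[R]_m -> 'cV[R]_m)
    (fhat Phi : 'cV[R]_m -> 'cV[R]_m -> 'cV[R]_m)
    (FK_DG FK_FV : ('I_N.+1 -> 'cV[R]_m) -> 'I_N.+1 -> 'cV[R]_m)
    (omega : 'I_N.+1 -> R) (J : R) (alpha : R -> R)
    (u : 'I_N.+1 -> R -> 'cV[R]_m) (uL uR : R -> 'cV[R]_m) (t : R)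
    (hS : strictly_convex_entropy Omega S)
    (hsym : forall x y, Omega x -> Omega y -> fhat x y = fhat y x)
    (hcons : forall x, Omega x -> fhat x x = fa x)
    (homega : forall j, 0 < omega j) (hJ : 0 < J)
    (hu : forall j, Omega (u j t))
    (huL : Omega (uL t)) (huR : Omega (uR t))
    (hdu : forall j, derivable (u j) t 1)
    (hscheme : forall j,
       (J * omega j) *: (u j)^`()%classic t
       = (1 - alpha t)
           *: scheme_rhs fhat Phi FK_DG (uL t) (uR t) (fun i => u i t) j
         + alpha t
           *: scheme_rhs fhat Phi FK_FV (uL t) (uR t) (fun i => u i t) j) :
  (forall j,
     (S \o u j)^`()%classic t
     = dotv (entropy_vars S (u j t)) ((u j)^`()%classic t))
  /\
  \sum_(j < N.+1) J * omega j * (S \o u j)^`()%classic t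
  = boundary_entropy_balance (entropy_vars S) Psi fhat Phi
      (uL t) (u ord0 t) (u ord_max t) (uR t)
    + (1 - alpha t)
        * inner_entropy_production (entropy_vars S) Psi FK_DG (fun i => u i t)
    + alpha t
        * inner_entropy_production (entropy_vars S) Psi FK_FV (fun i => u i t).
Proof.
have [_ _ _ dS] := hS.
have dSu j : (S \o u j)^`()%classic t
    = dotv (entropy_vars S (u j t)) ((u j)^`()%classic t).
  by apply: derive1_entropy => //; exact: dS.
split=> //.
(* The weight [J * omega j] moves inside the contraction to form the left side of [hscheme]. *)
under eq_bigr => j _ do rewrite dSu -dotvZr hscheme dotvDr !dotvZr.
(* The blending weights leave the sums because [alpha t] is the same at every node. *)
rewrite big_split /= -!mulr_sumr.
have sym0L := hsym _ _ huL (hu ord0).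
rewrite !(sum_dotv_scheme_rhs (entropy_vars S) Psi Phi _ (uR t)
  (u := fun i => u i t) sym0L).
by ring.
Qed.
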